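(* Let $m\geq 2$ be a fixed integer, and for real $x\geq 1$ let $$\mathcal{I}:=\{n\leq x:\mathcal{R}(m)=n\}$$ be the set of integers $2\leq n\leq x$ that ramify modulo $m$. Then $$\#\mathcal{I}\leq\left(1-\frac{1}{m}\right)x-\frac{\log x}{\log m}+O(1).$$
   Context: For a positive integer $k$, the residue of $n$ modulo $k$ means the least nonnegative residue, i.e. the integer $a\in\{0,1,\dots,k-1\}$ with $n\equiv a\pmod k$. Let $n\geq 2$ be an integer, let $m$ be a modulus, and let $a_1$ be the residue of $n$ modulo $m$. The integer $n$ is said to ramify modulo $m$ if there exists a positive integer $r<m$ such that the residue $a_2$ of $n$ modulo $r$ satisfies $a_1+a_2=m$. In that case $n$ is called a ramifier modulo $m$, and one writes $\mathcal{R}(m)=n$. The notation $O(1)$ denotes a quantity bounded in absolute value by an absolute constant (a constant allowed to depend on $m$ would be written $O_m(1)$). *)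

(* Defs.v *)
From mathcomp Require Import all_boot all_order all_algebra.
From mathcomp Require Import finmap.
From mathcomp Require Import all_classical all_reals all_analysis.

Set Implicit Arguments.
Unset Strict Implicit.
Unset Printing Implicit Defensive.

Import Order.TTheory GRing.Theory Num.Theory.

Local Open Scope classical_set_scope.
Local Open Scope ring_scope.

(* The relation R(m) = n. *)
Definition ramifies (m n : nat) : Prop :=
  (2 <= n)%N /\ exists r : nat, (0 < r < m)%N /\ (n %% m + n %% r)%N = m.

Definition ramifiers (R : realType) (m : nat) (x : R) : set nat :=
  [set n | n%:R <= x /\ ramifies m n].

(* [fset_set] is the empty set on infinite sets; this lemma shows that
   [ramifier_count] is the actual cardinality. *)
Lemma finite_ramifiers (R : realType) (m : nat) (x : R) :
  finite_set (ramifiers m x).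
Proof.
apply: (sub_finite_set _ (finite_II (Num.truncn x).+1)) => n [nx _] /=.
by rewrite ltnS truncn_ge_nat// (le_trans _ nx).
Qed.

Definition ramifier_count (R : realType) (m : nat) (x : R) : nat :=
  #|` fset_set (ramifiers m x)|.

(* Main.v *)
Require Import Defs.
From mathcomp Require Import all_boot all_order all_algebra.
From mathcomp Require Import finmap.
From mathcomp Require Import all_classical all_reals all_analysis.
From mathcomp Require Import lra.

(** The idea is that two residue classes modulo [m] contain no ramifier. In
    [a1 + a2 = m] one has [a2 < r < m], that is [a2 <= m - 2], so [a1 >= 2]
    ([ramifies_residue]). Hence every block of [m] consecutive integers
    contributes at most [m - 2] ramifiers, and the count up to [x] is at most
    [(1 - 2 / m) x + 3] ([count_residue_gt1], [ramifier_count_le]).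

    This beats the bound claimed by [x / m - log x / log m], so it remains to
    see that [log x / log m <= x / m + 1] uniformly in [m]. Writing
    [y = x / m], the left side is [log y / log m + 1], and
    [log y / log m <= y] because [log m >= log 2 >= 1 / 2] while
    [2 log y <= y] for every [y > 0] ([ln_ratio_le]). The constant is then
    [3 + 1 = 4]. *)

Import Order.TTheory GRing.Theory Num.Theory.

Local Open Scope ring_scope.

(** The second residue is smaller than [r], itself smaller than [m], so it
    falls short of [m] by at least two. *)
Lemma ramifies_residue (m n : nat) : ramifies m n -> (1 < n %% m)%N.
Proof.
case=> _ [r [/andP[r0 rm] sum_m]].
have a2_lt_r := ltn_pmod n r0.
rewrite -(ltn_add2r (n %% r)) sum_m add1n.
exact: leq_ltn_trans a2_lt_r rm.
Qed.

(** Each of the [n %/ m] complete blocks of length [m] below [n] loses the two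
    integers congruent to 0 and 1. *)
Lemma count_residue_gt1 (m n : nat) : (1 < m)%N ->
  (count (fun k => 1 < k %% m)%N (iota 0 n) + 2 * (n %/ m) <= n)%N.
Proof.
case: m => [|[|m]] // _; set P := fun k => _.
have full_blocks q : (count P (iota 0 (q * m.+2)) <= q * m)%N.
  elim: q => [//|q IHq].
  rewrite mulSnr iotaD count_cat mulSnr leq_add// add0n -[X in iota X]addn0.
  rewrite iotaDl count_map.
  rewrite (_ : count _ _ = count (fun k => 1 < k)%N (iota 0 m.+2)); last first.
    apply: eq_in_count => k; rewrite mem_iota /= add0n => km.
    by rewrite /P modnMDl modn_small.
  by rewrite /= !add0n (leq_trans (count_size _ _))// size_iota.
rewrite {1 3}(divn_eq n m.+2) iotaD count_cat add0n.
set q := (n %/ m.+2)%N.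
rewrite addnAC leq_add//; last by rewrite (leq_trans (count_size _ _))// size_iota.
by rewrite [leqRHS](mulnDr q 2 m) addnC (mulnC 2) leq_add2l.
Qed.

Lemma ramifier_count_le (R : realType) (m : nat) (x : R) :
  (1 < m)%N -> 1 <= x ->
  (ramifier_count m x)%:R <= x - 2 * (x / m%:R) + 3.
Proof.
move=> m1 x1; have x0 : 0 <= x by lra.
have m0 : 0 < m%:R :> R by rewrite ltr0n ltnW.
set n := (Num.truncn x).+1.
have count_n : (ramifier_count m x <= count (fun k => 1 < k %% m) (iota 0 n))%N.
  rewrite /ramifier_count -size_filter.
  set s := [seq _ <- _ | _].
  have uniq_s : uniq s by rewrite filter_uniq// iota_uniq.
  apply: (@leq_trans #|` [fset k in s]%fset|); last first.
    by rewrite card_fseq size_undup.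
  apply: fsubset_leq_card; apply/fsubsetP => k.
  rewrite in_fset_set; last exact: finite_ramifiers.
  rewrite inE => -[kx k_ram]; rewrite !inE /= mem_filter mem_iota /=.
  rewrite (ramifies_residue _ _ k_ram) /= add0n ltnS truncn_ge_nat//.
have := leq_trans (leq_add count_n (leqnn _)) (count_residue_gt1 m n m1).
rewrite -(ler_nat R) natrD natrM.
have n_le : n%:R <= x + 1 by rewrite -natr1 lerD2r truncn_le.
have x_lt : x < n%:R by rewrite truncnS_gt.
have : x / m%:R < (n %/ m)%:R + 1.
  rewrite ltr_pdivrMr// (lt_le_trans x_lt)// natr1 -natrM ler_nat.
  by rewrite ltnW// ltn_ceil// ltnW.
lra.
Qed.

(** Concavity: the logarithm lies below its tangent at 2, whose value at 0 is
    [ln 2 - 1 <= 0]. *)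
Lemma ln_le_half (R : realType) (y : R) : 0 < y -> ln y <= y / 2.
Proof.
move=> y0.
have := @le_ln1Dx R (y / 2 - 1); have := @le_ln1Dx R 1.
rewrite !subrKC lnM ?posrE ?invr_gt0// lnV ?posrE//.
move=> /(_ ltac:(lra)) ln2 /(_ ltac:(lra)).
lra.
Qed.

Lemma half_le_ln2 (R : realType) : 2^-1 <= ln (2 : R).
Proof.
have := @le_ln1Dx R (- 2^-1).
rewrite (_ : 1 + - 2^-1 = 2^-1 :> R); last lra.
rewrite lnV ?posrE// => /(_ ltac:(lra)); lra.
Qed.

Lemma ln_ratio_le (R : realType) (m : nat) (x : R) :
  (1 < m)%N -> 0 < x -> ln x / ln (m%:R : R) <= x / m%:R + 1.
Proof.
move=> m1 x0.
have m0 : 0 < m%:R :> R by rewrite ltr0n ltnW.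
have lnm : 2^-1 <= ln (m%:R : R).
  by rewrite (le_trans (half_le_ln2 R))// ler_ln ?posrE// ler_nat.
have y0 : 0 < x / m%:R by rewrite divr_gt0.
rewrite ler_pdivrMr; last lra.
rewrite -{1}[x](@divfK _ m%:R) ?gt_eqF// lnM ?posrE// mulrDl mul1r lerD2r.
exact: le_trans (ln_le_half R _ y0) (ler_wpM2l (ltW y0) lnm).
Qed.

Theorem theorem3p6 (R : realType) :
  exists C : R, forall m : nat, (2 <= m)%N -> forall x : R, 1 <= x ->
    (ramifier_count m x)%:R
      <= (1 - m%:R^-1) * x - ln x / ln (m%:R : R) + C.
Proof.
exists 4 => m m1 x x1.
have := ramifier_count_le R m x m1 x1.
have := ln_ratio_le R m x m1 ltac:(lra).
lra.
Qed.
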